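(* Let $M=G/K$ be a Riemannian symmetric space, of the ''non-compact case'' or of the ''compact case'' (as defined in the context). For $g\in G$, $x=\pi(g)$ and $v\in T_xM$, let $\omega_v=\mathrm{Ad}(g)\,v^{H}(e)$. Then $\omega_v\cdot x=v$, and $\langle u,v\rangle_x=\mathrm{B}(\xi,\omega_v)$ whenever $u=\xi\cdot x$ with $\xi\in\mathfrak{g}$.
   Context: $M=G/K$ is a Riemannian symmetric space, with $G$ the identity component of its isometry group, $K$ the stabiliser in $G$ of a point $o\in M$, $\mathfrak{g}$ and $\mathfrak{k}$ their Lie algebras, $\mathfrak{g}$ reductive. Let $s_o$ be the geodesic symmetry at $o$, $\theta(g)=s_o\circ g\circ s_o$ the associated involution of $G$, and $\mathfrak{g}=\mathfrak{k}+\mathfrak{p}$ the Cartan decomposition into the $+1$ and $-1$ eigenspaces of $d\theta$. The metric of $M$ is given by an $\mathrm{Ad}(K)$-invariant scalar product $Q$ on $\mathfrak{g}$: $\langle u,v\rangle_x=Q(g^{-1}\cdot u,g^{-1}\cdot v)$ if $x=g\cdot o$, where $T_oM$ is identified with $\mathfrak{p}$ through $\omega\mapsto\omega\cdot o$. It is assumed that $\mathfrak{k}$ and $\mathfrak{p}$ are $Q$-orthogonal. Non-compact case: $\mathfrak{g}$ admits an $\mathrm{Ad}(G)$-invariant, non-degenerate, symmetric bilinear form $B$ such that $Q(u,z)=-B(u,d\theta(z))$ is an $\mathrm{Ad}(K)$-invariant scalar product on $\mathfrak{g}$ (and this is the $Q$ above). Compact case: the scalar product $Q$ is $\mathrm{Ad}(G)$-invariant.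 Let $\mathrm{B}=B$ in the non-compact case and $\mathrm{B}=Q$ in the compact case. Extend $Q$ to a left-invariant Riemannian metric $(\cdot,\cdot)$ on $G$. Let $\pi:G\to M$, $\pi(g)=g\cdot o$, let $V_g=\ker d\pi(g)$ and let $H_g$ be the orthogonal complement of $V_g$ in $T_gG$. For $x=\pi(g)$ and $v\in T_xM$, $v^H(g)\in H_g$ is the unique vector with $d\pi(v^H(g))=v$, and $v^H(e)=dL_{g^{-1}}(v^H(g))\in\mathfrak{p}$, where $L$ denotes left translation. For $\xi\in\mathfrak{g}$ and $x\in M$, $\xi\cdot x=\frac{d}{dt}\big|_{t=0}\exp(t\xi)\cdot x\in T_xM$. *)

(* Defs.v *)
From HB Require Import structures.
From mathcomp Require Import all_boot all_order all_algebra.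
From mathcomp Require Import all_classical all_reals all_analysis.

Set Implicit Arguments.
Unset Strict Implicit.
Unset Printing Implicit Defensive.

Import Order.TTheory GRing.Theory Num.Theory.
Import numFieldNormedType.Exports.

Local Open Scope classical_set_scope.
Local Open Scope ring_scope.

(* [x |-> 'd f x] is C^k iff [x |-> 'd f x v] is C^k for every [v]; this uses
   that [V] is finite-dimensional, the only case considered below. [U] is
   meant to be open. *)
Fixpoint Ck (R : realType) (V W : normedModType R) (k : nat) (U : set V)
    (f : V -> W) : Prop :=
  match k with
  | 0%N => forall x, U x -> {for x, continuous f}
  | k'.+1 => (forall x, U x -> differentiable f x) /\
             (forall v : V, Ck k' U (fun x => 'd f x v))
  end.

Definition smooth_on (R : realType) (V W : normedModType R) (U : set V)
    (f : V -> W) : Prop := forall k, Ck k U f.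

(* [chart_inv] is only meaningful on the image of [chart_dom]. *)
Record chart (R : realType) (n : nat) (M : topologicalType) := Chart {
  chart_dom : set M;
  chart_map : M -> 'rV[R]_n;
  chart_inv : 'rV[R]_n -> M;
  chart_dom_open : open chart_dom;
  chart_img_open : open (chart_map @` chart_dom);
  chart_mapK : {in chart_dom, cancel chart_map chart_inv};
  chart_map_cont : forall x, chart_dom x -> {for x, continuous chart_map};
  chart_inv_cont :
    forall z, (chart_map @` chart_dom) z -> {for z, continuous chart_inv} }.

Definition chart_img (R : realType) (n : nat) (M : topologicalType)
    (c : chart R n M) : set 'rV[R]_n := chart_map c @` chart_dom c.

HB.mixin Record isManifold (R : realType) (n : nat) M of Topological M := {
  atlas : set (chart R n M);
  manifold_hausdorff : hausdorff_space M;
  manifold_second_countable : @second_countable M;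
  atlas_cover : forall x : M, exists2 c, atlas c & chart_dom c x;
  atlas_compat : forall c d, atlas c -> atlas d ->
    smooth_on (chart_map c @` (chart_dom c `&` chart_dom d))
              (chart_map d \o chart_inv c) }.

#[short(type="manifoldType")]
HB.structure Definition Manifold (R : realType) (n : nat) :=
  {M of isManifold R n M & Topological M}.

Section Smooth.
Variable R : realType.

Definition smooth_fun (n : nat) (M : manifoldType R n) (f : M -> R) : Prop :=
  forall c : chart R n M, atlas c ->
    smooth_on (chart_img c) (f \o chart_inv c : 'rV[R]_n -> R^o).

Definition smooth_map (m n : nat) (M : manifoldType R m)
    (N : manifoldType R n) (F : M -> N) : Prop :=
  continuous F /\
  forall (c : chart R m M) (d : chart R n N), atlas c -> atlas d ->
    smooth_on (chart_map c @` (chart_dom c `&` F @^-1` chart_dom d))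
              (chart_map d \o F \o chart_inv c).

(* Joint smoothness, that is, smoothness of the map [M1 * M2 -> N] for the
   product charts. *)
Definition smooth_map2 (m1 m2 n : nat) (M1 : manifoldType R m1)
    (M2 : manifoldType R m2) (N : manifoldType R n) (F : M1 -> M2 -> N) : Prop :=
  continuous (fun p : M1 * M2 => F p.1 p.2) /\
  forall (c1 : chart R m1 M1) (c2 : chart R m2 M2) (d : chart R n N),
    atlas c1 -> atlas c2 -> atlas d ->
    smooth_on
      [set z : 'rV[R]_m1 * 'rV[R]_m2 | [/\ chart_img c1 z.1, chart_img c2 z.2 &
         chart_dom d (F (chart_inv c1 z.1) (chart_inv c2 z.2))]]
      (fun z => chart_map d (F (chart_inv c1 z.1) (chart_inv c2 z.2))).

End Smooth.

(* A tangent vector at [x] is a derivation at [x] of the algebra of smooth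
   functions. It is represented by a functional on all functions that vanishes
   outside the smooth ones, so that equality of functionals is equality of
   tangent vectors. *)
Definition tvec (R : realType) (M : Type) : Type := (M -> R) -> R^o.

HB.instance Definition _ (R : realType) (M : Type) :=
  GRing.Lmodule.copy (tvec R M) ((M -> R) -> R^o).

Section Tangent.
Variable R : realType.

Definition tangent (n : nat) (M : manifoldType R n) (x : M) : set (tvec R M) :=
  [set D | [/\ forall f, ~ smooth_fun f -> D f = 0,
      forall (a : R) f h, smooth_fun f -> smooth_fun h ->
        D (fun y => a * f y + h y) = a * D f + D h &
      forall f h, smooth_fun f -> smooth_fun h ->
        D (fun y => f y * h y) = D f * h x + f x * D h]].

(* The differential of [F]; the base point is implicit in [D]. *)
Definition tmap (m n : nat) (M : manifoldType R m) (N : manifoldType R n)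
    (F : M -> N) (D : tvec R M) : tvec R N :=
  fun f => if `[< smooth_fun f >] then D (f \o F) else 0.

Definition velocity (n : nat) (M : manifoldType R n) (c : R -> M) (t : R) :
    tvec R M :=
  fun f => if `[< smooth_fun f >] then 'D_1 (f \o c : R -> R^o) t else 0.

Definition coord_vec (n : nat) (M : manifoldType R n) (c : chart R n M)
    (z : 'rV[R]_n) (i : 'I_n) : tvec R M :=
  fun f => if `[< smooth_fun f >]
           then 'd (f \o chart_inv c : 'rV[R]_n -> R^o) z (delta_mx 0 i) else 0.

End Tangent.

Section Forms.
Variables (R : realType) (V : lmodType R).
Implicit Types (E : set V) (q : V -> V -> R).

Definition bilinear_on E q : Prop :=
  forall (a : R) u v w, E u -> E v -> E w ->
    q (a *: u + v) w = a * q u w + q v w /\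
    q w (a *: u + v) = a * q w u + q w v.

Definition symmetric_on E q : Prop := forall u v, E u -> E v -> q u v = q v u.

Definition nondegenerate_on E q : Prop :=
  forall u, E u -> (forall v, E v -> q u v = 0) -> u = 0.

Definition scalar_product_on E q : Prop :=
  [/\ bilinear_on E q, symmetric_on E q &
      forall u, E u -> u != 0 -> 0 < q u u].

End Forms.

Record riemannian (R : realType) (n : nat) (M : manifoldType R n) :=
  Riemannian {
  metric :> M -> tvec R M -> tvec R M -> R;
  metric_scalar : forall x, scalar_product_on (tangent x) (metric x);
  metric_smooth : forall (c : chart R n M) (i j : 'I_n), atlas c ->
    smooth_on (chart_img c)
      (fun z => metric (chart_inv c z) (coord_vec c z i) (coord_vec c z j)
         : R^o) }.

Section Symmetric.
Variables (R : realType) (n : nat) (M : manifoldType R n) (ip : riemannian M).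

Definition isometries : set (M -> M) :=
  [set phi | (exists psi : M -> M, [/\ smooth_map phi, smooth_map psi,
                cancel phi psi & cancel psi phi]) /\
     forall x u v, tangent x u -> tangent x v ->
       ip (phi x) (tmap phi u) (tmap phi v) = ip x u v].

(* On a connected manifold at most one isometry fixes [x] and has differential
   [-id] there; in normal coordinates at [x] it is [z |-> - z]. *)
Definition geodesic_symmetry (x : M) (s : M -> M) : Prop :=
  [/\ isometries s, s x = x & forall u, tangent x u -> tmap s u = - u].

Definition symmetric_space : Prop :=
  connected [set: M] /\ forall x, exists s, geodesic_symmetry x s.

End Symmetric.

HB.mixin Record isLieGroup (R : realType) (m : nat) G
    of Manifold R m G & Group G := {
  lie_mul_smooth : smooth_map2 (fun g h : G => (g * h)%g);
  lie_inv_smooth : smooth_map (fun g : G => g^-1%g) }.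

#[short(type="lieGroupType")]
HB.structure Definition LieGroup (R : realType) (m : nat) :=
  {G of isLieGroup R m G & Manifold R m G & Group G}.

Section LieGroups.
Variables (R : realType) (m : nat) (G : lieGroupType R m).
Local Notation vec := (tvec R G).

Definition lie_alg : set vec := tangent (1%g : G).

Definition ltrans (g h : G) : G := (g * h)%g.

Definition Ad (g : G) : vec -> vec := tmap (fun h : G => (g * h * g^-1)%g).

(* The left-invariant vector field that extends [X] maps [f] to
   [fun g => X (f \o ltrans g)]. *)
Definition bracket (X Y : vec) : vec := fun f =>
  X (fun g => Y (f \o ltrans g)) - Y (fun g => X (f \o ltrans g)).

Definition lie_ideal (I : set vec) : Prop :=
  [/\ I `<=` lie_alg, I 0,
      forall (a : R) X Y, I X -> I Y -> I (a *: X + Y) &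
      forall X Y, lie_alg X -> I Y -> I (bracket X Y)].

Definition reductive : Prop :=
  forall I, lie_ideal I -> exists J, [/\ lie_ideal J, I `&` J = [set 0] &
    lie_alg = [set X + Y | X in I & Y in J]].

(* [t |-> e (t *: X)] is the one-parameter subgroup with initial velocity [X];
   a homomorphism from the reals that is differentiable at 0 is smooth. *)
Definition is_exponential (e : vec -> G) : Prop :=
  forall X, lie_alg X ->
    (forall s t : R, e ((s + t) *: X) = (e (s *: X) * e (t *: X))%g) /\
    (forall f : G -> R, smooth_fun f ->
       is_derive (0 : R) 1 (fun t : R => f (e (t *: X)) : R^o) (X f)).

Definition lie_sub (e : vec -> G) (K : set G) : set vec :=
  [set X | lie_alg X /\ forall t : R, K (e (t *: X))].

Definition Ad_invariant (A : set G) (q : vec -> vec -> R) : Prop :=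
  forall g u v, A g -> lie_alg u -> lie_alg v -> q (Ad g u) (Ad g v) = q u v.

Definition left_invariant_metric (q : vec -> vec -> R) (g : G) (X Y : vec) : R :=
  q (tmap (ltrans g^-1%g) X) (tmap (ltrans g^-1%g) Y).

Definition dtheta_eigenspace (theta : G -> G) (a : R) : set vec :=
  [set X | lie_alg X /\ tmap theta X = a *: X].

Definition noncompact_case (theta : G -> G) (Q B : vec -> vec -> R) : Prop :=
  [/\ bilinear_on lie_alg B, symmetric_on lie_alg B,
      nondegenerate_on lie_alg B, Ad_invariant setT B &
      forall u z, lie_alg u -> lie_alg z -> Q u z = - B u (tmap theta z)].

Definition compact_case (Q B : vec -> vec -> R) : Prop :=
  Ad_invariant setT Q /\
  forall u z, lie_alg u -> lie_alg z -> B u z = Q u z.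

End LieGroups.

Section Action.
Variables (R : realType) (n m : nat).
Variables (M : manifoldType R n) (G : lieGroupType R m).
Variables (ip : riemannian M) (act : G -> M -> M).

(* [act] identifies [G] with the identity component of the isometry group of
   [M] for the compact-open topology. The third clause says that [G] carries
   the topology induced by [act]; this determines the smooth structure of the
   Lie group [G], and the smoothness of the action is then part of the
   Myers-Steenrod theorem. *)
Definition isometry_identity_component : Prop :=
  [/\ (forall g h x, act (g * h)%g x = act g (act h x)) /\ injective act,
      range act = connected_component
        (isometries ip : set {compact-open, M -> M}) (@idfun M),
      forall U : set G, open U <->
        exists2 V : set {compact-open, M -> M}, open V & U = act @^-1` V &
      smooth_map2 act].

Definition stabiliser (x : M) : set G := [set g | act g x = x].

Definition Cartan_involution (s : M -> M) (theta : G -> G) : Prop :=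
  [/\ forall g, act (theta g) = s \o act g \o s,
      involutive theta & smooth_map theta].

Definition inf_action (e : tvec R G -> G) (xi : tvec R G) (x : M) : tvec R M :=
  velocity (fun t : R => act (e (t *: xi)) x) 0.

Definition orbit_proj (o : M) (g : G) : M := act g o.

Definition vertical (o : M) (g : G) : set (tvec R G) :=
  [set X | tangent g X /\ tmap (orbit_proj o) X = 0].

Definition horizontal (q : tvec R G -> tvec R G -> R) (o : M) (g : G) :
    set (tvec R G) :=
  [set X | tangent g X /\
     forall Y, vertical o g Y -> left_invariant_metric q g X Y = 0].

Definition hlift (q : tvec R G -> tvec R G -> R) (o : M) (g : G)
    (v : tvec R M) : tvec R G :=
  xget 0 [set X | horizontal q o g X /\ tmap (orbit_proj o) X = v].

Definition hlift_e (q : tvec R G -> tvec R G -> R) (o : M) (g : G)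
    (v : tvec R M) : tvec R G :=
  tmap (ltrans g^-1%g) (hlift q o g v).

End Action.

(* Main.v *)
(* Write pi g = g . o and let p be the (-1)-eigenspace of d theta. The kernel of
   d pi in the Lie algebra is Q-orthogonal to p, so the horizontal lift of v at g
   is the left translate of the unique w in p with d pi (w) = d(g^-1)(v), and
   omega_v = Ad(g) w. As (g h g^-1) . x = g . pi h for all h, this gives
   omega_v . x = dg (d pi (w)) = v. By Ad-invariance B(xi, omega_v) is
   Q(eta, w) with eta = Ad(g^-1) xi; only the p-component of eta contributes,
   and d pi maps it to d(g^-1)(u).
   The orthogonality uses theta 1 = 1, which is not obvious, as it says that s is
   an involution. If it fails, a vector of p is tangent at two distinct points, and
   bump functions show that it vanishes. *)
From HB Require Import structures.
Require Import Defs.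
From mathcomp Require Import all_boot all_order all_algebra.
From mathcomp Require Import all_classical all_reals all_analysis.
From mathcomp Require Import ring.

Set Implicit Arguments.
Unset Strict Implicit.
Unset Printing Implicit Defensive.

Import Order.TTheory GRing.Theory Num.Theory.
Import numFieldNormedType.Exports.

Local Open Scope classical_set_scope.
Local Open Scope ring_scope.

(** * Calculus of C^k maps *)

Section CkCalculus.
Variable R : realType.
Implicit Types V W : normedModType R.

(** The first-order expansion of [f] at [x] is also one of [g], since the two agree near [x];
    uniqueness of the differential concludes. *)
Lemma near_eq_is_diff V W (f g : V -> W) (x : V) (df : V -> W) :
  (\near x, f x = g x) -> is_diff x f df -> is_diff x g df.
Proof.
move=> fg fdf.
have fx : differentiable f x by [].
have fgx : f x = g x by exact: nbhs_singleton fg.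
have gE : g \o shift x = cst (g x) + 'd f x +o_ 0 id.
  apply/eqaddoP => _/posnumP[eps].
  have /eqaddoP /(_ _ (gt0 eps)) fE := diff_locally fx.
  have fg0 : \forall h \near 0, f (h + x) = g (h + x).
    by move: fg; rewrite (near_shift 0 x); apply: filterS => h /=; rewrite subr0.
  apply: filterS2 fE fg0 => h; rewrite !fctE /= => + <-.
  by rewrite fgx.
have dfE := diff_unique (diff_continuous fx) gE.
apply: DiffDef; last by rewrite dfE diff_val.
by apply/diff_locallyP; rewrite dfE; split=> //; exact: diff_continuous.
Qed.

Lemma Ck_sub V W k (U U' : set V) (f : V -> W) :
  U `<=` U' -> Ck k U' f -> Ck k U f.
Proof.
move=> UU'; elim: k f => [|k IH] f /= fU'; first by move=> x /UU'/fU'.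
by case: fU' => df fU'; split=> [x /UU'/df //|v]; exact: IH.
Qed.

(** Every clause of [Ck] is a condition at single points of [U], with differentials taken in the
    whole space [V]. Smoothness can thus be checked one chart at a time. *)
Lemma Ck_local V W k (U : set V) (f : V -> W) :
  (forall x, U x -> exists U', U' x /\ Ck k U' f) -> Ck k U f.
Proof.
elim: k f => [|k IH] f fU /=.
  by move=> x /fU[U' [U'x]]; apply.
split=> [x Ux|v].
  by have [U' [U'x [df _]]] := fU x Ux; exact: df.
apply: IH => x /fU[U' [U'x [_ fU']]]; exists U'; split=> //; exact: fU'.
Qed.

(** Openness of [U] makes [f] and [g] agree near each of its points, so that they have the same
    differential there. *)
Lemma Ck_eq V W k (U : set V) (f g : V -> W) :
  open U -> (forall x, U x -> f x = g x) -> Ck k U f -> Ck k U g.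
Proof.
move=> oU; elim: k f g => [|k IH] f g fg /= fU.
  move=> x Ux; suff: g @ x --> g x by [].
  rewrite -fg //; apply: cvg_trans (fU _ Ux); apply: near_eq_cvg.
  by apply: filterS (open_nbhs_nbhs (conj oU Ux)) => y /fg.
have [df fU'] := fU; have dg x : U x -> is_diff x g ('d f x).
  move=> Ux; apply: (near_eq_is_diff _ (differentiableP (df _ Ux))).
  exact: filterS (open_nbhs_nbhs (conj oU Ux)).
split=> [x /dg dgx //|v]; apply: IH (fU' v) => x /dg dgx.
by rewrite (diff_val (is_diff_def := dgx)).
Qed.

Lemma Ck_le V W k (U : set V) (f : V -> W) : Ck k.+1 U f -> Ck k U f.
Proof.
elim: k f => [|k IH] f [df fU]; first by move=> x /df/differentiable_continuous.
by split=> // v; apply: IH; exact: fU.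
Qed.

Lemma Ck_cst V W k (U : set V) (a : W) : Ck k U (cst a).
Proof.
elim: k a => [|k IH] a /=; first by move=> x _; exact: cst_continuous.
split=> [x _|v]; first exact: differentiable_cst.
by rewrite (_ : (fun _ => _) = cst 0)//; apply/funext => x; rewrite diff_cst.
Qed.

Lemma CkD V W k (U : set V) (f g : V -> W) :
  open U -> Ck k U f -> Ck k U g -> Ck k U (fun x => f x + g x).
Proof.
move=> oU; elim: k f g => [|k IH] f g fU gU.
  by move=> x Ux; apply: continuousD; [exact: fU|exact: gU].
have [df fU'] := fU; have [dg gU'] := gU.
split=> [x Ux|v]; first by apply: differentiableD; [exact: df|exact: dg].
apply: Ck_eq oU _ (IH _ _ (fU' v) (gU' v)) => x Ux.
exact: esym (congr1 (@^~ v) (diffD (df _ Ux) (dg _ Ux))).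
Qed.

Lemma CkM V k (U : set V) (f g : V -> R^o) :
  open U -> Ck k U f -> Ck k U g -> Ck k U (fun x => f x * g x : R^o).
Proof.
move=> oU; elim: k f g => [|k IH] f g fU gU.
  by move=> x Ux; apply: (@continuousM R V); [exact: fU|exact: gU].
have [df fU'] := fU; have [dg gU'] := gU.
split=> [x Ux|v]; first by apply: differentiableM; [exact: df|exact: dg].
(* The product rule multiplies a derivative by an undifferentiated factor, which [Ck_le] brings down
   to order [k]. *)
apply: Ck_eq oU _ (CkD oU (IH _ _ (Ck_le fU) (gU' v)) (IH _ _ (Ck_le gU) (fU' v))).
move=> x Ux; exact: esym (congr1 (@^~ v) (diffM (df _ Ux) (dg _ Ux))).
Qed.

Lemma Ck_sum V W k (U : set V) n (f : 'I_n -> V -> W) :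
  open U -> (forall i, Ck k U (f i)) -> Ck k U (fun x => \sum_i f i x).
Proof.
move=> oU; elim: n f => [|n IH] f fU.
  by apply: Ck_eq oU _ (Ck_cst k U 0) => x _; rewrite big_ord0.
apply: Ck_eq oU _ (CkD oU (IH _ (fun i => fU (widen_ord (leqnSn n) i))) (fU ord_max)).
by move=> x _; rewrite big_ord_recr.
Qed.

Lemma Ck_linear V W k (U : set V) (L : {linear V -> W}) :
  continuous L -> Ck k U L.
Proof.
move=> cL; case: k => [|k] /=; first by move=> x _; exact: cL.
split=> [x _|v]; first exact: linear_differentiable.
have -> : (fun x => 'd L x v) = cst (L v) by apply/funext => x; rewrite diff_lin.
exact: Ck_cst.
Qed.

Lemma Ck_linear_comp V W W' k (U : set V) (f : V -> W) (L : {linear W -> W'}) :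
  open U -> continuous L -> Ck k U f -> Ck k U (L \o f).
Proof.
move=> oU cL; elim: k f => [|k IH] f fU.
  by move=> x Ux; apply: continuous_comp; [exact: fU|exact: cL].
have [df fU'] := fU; have dL y := linear_differentiable y cL.
split=> [x Ux|v]; first by apply: differentiable_comp => //; exact: df.
apply: Ck_eq oU _ (IH _ (fU' v)) => x Ux.
by rewrite diff_comp //= ?diff_lin //; exact: df.
Qed.

(** As the differential of [f] is the constant [L], the derivative of [h \o f] along [v] is that of
    [h] along [L v], composed with [f]. The induction differentiates only [h], so no basis of [V']
    has to be chosen; this suits product spaces. *)
Lemma Ck_comp_affine V V' W k (U : set V) (U' : set V') (f : V -> V') (h : V' -> W)
    (L : V -> V') :
  open U -> (forall x, is_diff x f L) -> (forall x, U x -> U' (f x)) ->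
  Ck k U' h -> Ck k U (h \o f).
Proof.
move=> oU dfL UU'.
have df x : differentiable f x by [].
elim: k h => [|k IH] h hU.
  move=> x Ux; apply: continuous_comp; last exact/hU/UU'.
  exact: differentiable_continuous.
have [dh hU'] := hU.
split=> [x Ux|v]; first by apply: differentiable_comp => //; exact/dh/UU'.
apply: Ck_eq oU _ (IH _ (hU' (L v))) => x Ux.
by rewrite diff_comp //= ?diff_val //; exact/dh/UU'.
Qed.

(* The target [V'] is assumed to have a finite basis [b] with coordinates [l];
   the chain rule is then a finite sum of products of scalar functions. *)
Lemma Ck_comp V V' p (b : 'I_p -> V') (l : 'I_p -> {linear V' -> R^o}) k
    (U : set V) (U' : set V') (f : V -> V') (h : V' -> R^o) :
  (forall v, v = \sum_i l i v *: b i) -> (forall i, continuous (l i)) ->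
  open U -> (forall x, U x -> U' (f x)) ->
  Ck k U f -> Ck k U' h -> Ck k U (h \o f).
Proof.
move=> bE cl oU UU' + +; elim: k h => [|k IH] h fU hU.
  by move=> x Ux; apply: continuous_comp; [exact: fU|exact/hU/UU'].
have [df fU'] := fU; have [dh hU'] := hU.
split=> [x Ux|v].
  by apply: differentiable_comp; [exact: df|exact/dh/UU'].
pose g x := \sum_i l i ('d f x v) * 'd h (f x) (b i) : R^o.
apply: (@Ck_eq _ _ _ _ g) => // [x Ux|].
  rewrite diff_comp /=; [|exact: df|exact/dh/UU'].
  by rewrite [in RHS](bE ('d f x v)) linear_sum; apply: eq_bigr => i _; rewrite linearZ.
apply: Ck_sum => // i; apply: CkM => //.
  exact: (Ck_linear_comp oU (cl i) (fU' v)).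
exact: IH (Ck_le fU) (hU' _).
Qed.

Definition rVcoord n (i : 'I_n) (v : 'rV[R]_n) : R^o := v 0 i.

Lemma rVcoord_is_linear n (i : 'I_n) : linear (rVcoord i).
Proof. by move=> a u v; rewrite /rVcoord !mxE. Qed.

HB.instance Definition _ n (i : 'I_n) :=
  GRing.isLinear.Build R 'rV[R]_n R^o *:%R (rVcoord i) (rVcoord_is_linear i).

Lemma rVcoord_continuous n (i : 'I_n) : continuous (rVcoord i).
Proof. exact: coord_continuous. Qed.

Lemma Ck_comp_rV V n k (U : set V) (U' : set 'rV[R]_n) (f : V -> 'rV[R]_n)
    (h : 'rV[R]_n -> R^o) :
  open U -> (forall x, U x -> U' (f x)) ->
  Ck k U f -> Ck k U' h -> Ck k U (h \o f).
Proof.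
apply: (@Ck_comp _ _ _ (delta_mx 0) (@rVcoord n)) => [v|i].
  exact: row_sum_delta.
exact: rVcoord_continuous.
Qed.

Lemma Ck_comp_scalar V k (U : set V) (U' : set R^o) (f : V -> R^o)
    (h : R^o -> R^o) :
  open U -> (forall x, U x -> U' (f x)) ->
  Ck k U f -> Ck k U' h -> Ck k U (h \o f).
Proof.
move=> oU UU'; apply: (@Ck_comp V R^o 1 (fun=> 1) (fun=> idfun)) oU UU' => [v|i].
  by rewrite big_ord1 [RHS]mulr1.
by move=> x.
Qed.

End CkCalculus.

(** * Smooth maps between manifolds *)

Section SmoothMaps.
Variable R : realType.

Lemma chart_mapKx n (M : topologicalType) (c : chart R n M) (x : M) :
  chart_dom c x -> chart_inv c (chart_map c x) = x.
Proof. by move=> cx; apply: chart_mapK; exact: mem_set. Qed.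

(** Near an image point the set is the preimage of [D] under the continuous [chart_inv], cut down to
    the open image of the chart. *)
Lemma open_chart_image n (M : topologicalType) (c : chart R n M) (D : set M) :
  open D -> open (chart_map c @` (chart_dom c `&` D)).
Proof.
move=> oD; rewrite openE => _ [x [cx Dx] <-].
have img_cx : (chart_map c @` chart_dom c) (chart_map c x) by exists x.
have nD : nbhs (chart_map c x) (chart_inv c @^-1` D).
  apply: (chart_inv_cont img_cx); rewrite chart_mapKx//.
  exact: open_nbhs_nbhs.
apply: filterS2 nD (open_nbhs_nbhs (conj (chart_img_open (c := c)) img_cx)).
by move=> z /= Dz [y cy yz]; move: Dz; rewrite -yz chart_mapKx// => Dy; exists y.
Qed.

Section Functions.
Variables (n : nat) (M : manifoldType R n).
Implicit Types f h : M -> R.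

Lemma smooth_fun_lin (a : R) f h :
  smooth_fun f -> smooth_fun h -> smooth_fun (fun x => a * f x + h x).
Proof.
move=> sf sh c ac k; have oc : open (chart_img c) by exact: chart_img_open.
apply: (CkD oc); last exact: sh.
by apply: (CkM oc); [exact: Ck_cst|exact: sf].
Qed.

Lemma smooth_funM f h :
  smooth_fun f -> smooth_fun h -> smooth_fun (fun x => f x * h x).
Proof.
move=> sf sh c ac k; have oc : open (chart_img c) by exact: chart_img_open.
by apply: (CkM oc); [exact: sf|exact: sh].
Qed.

End Functions.

(** Around [x], with a chart [d] at [F x], the coordinate expression factors as [f \o chart_inv d]
    after [chart_map d \o F \o chart_inv c]. *)
Lemma smooth_fun_comp m n (M : manifoldType R m) (N : manifoldType R n)
    (F : M -> N) (f : N -> R) :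
  smooth_map F -> smooth_fun f -> smooth_fun (f \o F).
Proof.
move=> [cF sF] sf c ac k; apply: Ck_local => _ [x cx <-].
have [d ad dFx] := atlas_cover (F x).
exists (chart_map c @` (chart_dom c `&` F @^-1` chart_dom d)); split; first by exists x.
have oU : open (chart_map c @` (chart_dom c `&` F @^-1` chart_dom d)).
  apply: open_chart_image; apply: open_comp => [y _|]; first exact: cF.
  exact: chart_dom_open.
apply: (@Ck_eq _ _ _ _ _ ((f \o chart_inv d) \o (chart_map d \o F \o chart_inv c))) => //.
  by move=> _ [y [cy dFy] <-] /=; rewrite !chart_mapKx.
apply: (@Ck_comp_rV _ _ _ _ _ (chart_img d)) => //; last exact: sf.
  by move=> _ [y [cy dFy] <-]; exists (F y) => //=; rewrite chart_mapKx.
exact: sF.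
Qed.

(** In charts, fixing the first argument is composition with the affine inclusion [j], whose
    differential is [z |-> (0, z)]. *)
Lemma smooth_map2_section_r m1 m2 n (M1 : manifoldType R m1) (M2 : manifoldType R m2)
    (N : manifoldType R n) (F : M1 -> M2 -> N) (a : M1) :
  smooth_map2 F -> smooth_map (F a).
Proof.
move=> [cF sF]; have cFa : continuous (F a).
  move=> y; apply: (@continuous_comp _ _ _ (pair a) (fun p => F p.1 p.2)); last exact: cF.
  by apply: cvg_pair; [exact: cvg_cst|exact: cvg_id].
split=> // c d ac ad k; have [c1 ac1 c1a] := atlas_cover a.
have oU : open (chart_map c @` (chart_dom c `&` F a @^-1` chart_dom d)).
  apply: open_chart_image; apply: open_comp => [y _|]; first exact: cFa.
  exact: chart_dom_open.
pose j (z : 'rV[R]_m2) := (chart_map c1 a, z).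
pose h z := chart_map d (F (chart_inv c1 z.1) (chart_inv c z.2)).
apply: (@Ck_eq _ _ _ _ _ (h \o j)) => //.
  by move=> _ [y [cy dFy] <-]; rewrite /h /j /= !chart_mapKx.
apply: (Ck_comp_affine (L := fun z => (0, z)) oU _ _ (sF _ _ _ ac1 ac ad k)).
move=> _ [y [cy dFy] <-]; split; first by exists a.
  by exists y.
by rewrite /= !chart_mapKx.
Qed.

Lemma smooth_map2_section_l m1 m2 n (M1 : manifoldType R m1) (M2 : manifoldType R m2)
    (N : manifoldType R n) (F : M1 -> M2 -> N) (b : M2) :
  smooth_map2 F -> smooth_map (F ^~ b).
Proof.
move=> [cF sF]; have cFb : continuous (F ^~ b).
  move=> y; apply: (@continuous_comp _ _ _ (pair ^~ b) (fun p => F p.1 p.2)); last exact: cF.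
  by apply: cvg_pair; [exact: cvg_id|exact: cvg_cst].
split=> // c d ac ad k; have [c2 ac2 c2b] := atlas_cover b.
have oU : open (chart_map c @` (chart_dom c `&` F ^~ b @^-1` chart_dom d)).
  apply: open_chart_image; apply: open_comp => [y _|]; first exact: cFb.
  exact: chart_dom_open.
pose j (z : 'rV[R]_m1) := (z, chart_map c2 b).
pose h z := chart_map d (F (chart_inv c z.1) (chart_inv c2 z.2)).
apply: (@Ck_eq _ _ _ _ _ (h \o j)) => //.
  by move=> _ [y [cy dFy] <-]; rewrite /h /j /= !chart_mapKx.
apply: (Ck_comp_affine (L := fun z => (z, 0)) oU _ _ (sF _ _ _ ac ac2 ad k)).
move=> _ [y [cy dFy] <-]; split; [by exists y|by exists b|].
by rewrite /= !chart_mapKx.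
Qed.

End SmoothMaps.

(** * Smooth functions separate points *)

Section FlatFunction.
Variable R : realType.

(** For [n = 0] this is the standard smooth function that is flat at the origin. The negative powers
    of [t] are included so that derivatives are combinations of members of the family. *)
Definition flat (n : nat) (t : R) : R :=
  if 0 < t then t^-1 ^+ n * expR (- t^-1) else 0.

Lemma flat_ge0 n t : 0 <= flat n t.
Proof.
rewrite /flat; case: ifP => // t0.
by rewrite mulr_ge0 ?expR_ge0// exprn_ge0// invr_ge0 ltW.
Qed.

(* [expR (1 / t)] dominates the [n + 2]-nd term of its series. *)
Lemma flat_le n t : flat n t <= n.+2`!%:R * t ^+ 2.
Proof.
rewrite /flat; case: ifP => [t0|_]; last by rewrite mulr_ge0 ?sqr_ge0.
have y0 : 0 < t^-1 by rewrite invr_gt0.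
have F0 : 0 < n.+2`!%:R :> R by rewrite ltr0n fact_gt0.
have h : t^-1 ^+ n.+2 <= n.+2`!%:R * expR t^-1.
  rewrite mulrC -ler_pdivrMr//.
  by apply: le_trans (expR_ge1Dxn n.+1 (ltW y0)); rewrite lerDr.
rewrite expRN ler_pdivrMr ?expR_gt0// mulrAC.
apply: le_trans (ler_wpM2r (sqr_ge0 t) h).
by rewrite -addn2 exprD -mulrA -exprMn mulVf ?gt_eqF// expr1n mulr1.
Qed.

Lemma is_derive_flat n (t : R) :
  is_derive t 1 (flat n) (flat n.+2 t - n%:R * flat n.+1 t).
Proof.
have [t0|t0|t0] := ltgtP t 0.
- rewrite {2 3}/flat ltNge (ltW t0)/= mulr0 subr0.
  apply: (@near_eq_is_derive _ _ _ (cst 0)).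
  apply: filterS (open_nbhs_nbhs (conj (@open_lt _ 0) t0)) => s /= s0.
  by rewrite /flat ltNge (ltW s0).
- rewrite {2 3}/flat t0.
  apply: (@near_eq_is_derive _ _ _ (fun s : R => s^-1 ^+ n * expR (- s^-1))).
    apply: filterS (open_nbhs_nbhs (conj (@open_gt _ 0) t0)) => s /= s0.
    by rewrite /flat s0.
  have dV : is_derive t 1 (fun s : R => s^-1) (- t ^- 2 *: 1).
    by apply: is_deriveV; rewrite gt_eqF.
  have dE : is_derive t 1 (fun s : R => expR (- s^-1)) (expR (- t^-1) * - (- t ^- 2 *: 1)).
    exact: (is_derive1_comp (is_derive_expR _) (is_deriveN dV)).
  have dX := is_deriveX n dV; rewrite exprfctE in dX.
  apply: (is_derive_eq (is_deriveM dX dE)).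
  rewrite /GRing.scale /= -exprVn; move: t^-1 (expR _) => y E.
  by case: n {dX} => [|m]; rewrite ?expr0 /= ?exprS; ring.
(* At the origin the derivative is 0: the quadratic bound [flat_le] leaves one factor of [h] in the
   difference quotient. *)
- rewrite t0 {2 3}/flat ltxx mulr0 subr0.
  suff H : (fun h : R => h^-1 *: (flat n (h *: 1 + 0) - flat n 0)) @ 0^' --> (0 : R).
    by apply: DeriveDef; [apply/cvg_ex; exists 0|exact: cvg_lim H].
  pose C : R := n.+2`!%:R.
  have H0 : (fun h : R => C * `|h|) @ 0^' --> (0 : R).
    have : (fun h : R => C * `|h|) @ (0 : R) --> C * `|0 : R|.
      by apply: cvgMl_tmp; exact: norm_continuous.
    by rewrite normr0 mulr0; apply: cvg_trans; apply: cvg_app; exact: cvg_within.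
  apply: norm_cvg0; apply: (squeeze_cvgr _ (cvg_cst 0) H0).
  near=> h; rewrite normr_ge0/= (_ : h *: 1 + 0 = h); last by rewrite addr0 [LHS]mulr1.
  rewrite normrM normfV.
  have h0 : 0 < `|h| by rewrite normr_gt0; near: h; exact: nbhs_dnbhs_neq.
  rewrite /flat ltxx subr0 -/(flat n h) ger0_norm ?flat_ge0//.
  rewrite mulrC ler_pdivrMr// -mulrA -expr2 -normrX.
  by rewrite ger0_norm ?sqr_ge0//; exact: flat_le.
Unshelve. all: by end_near. Qed.

(** The derivative of [flat n] combines [flat n.+2] and [flat n.+1], so the induction on [k] runs
    over all [n] at once. *)
Lemma Ck_flat k n (U : set R^o) : Ck k U (flat n : R^o -> R^o).
Proof.
apply: (@Ck_sub _ _ _ _ _ setT) => //.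
have dF m (t : R) := is_derive_flat m t.
have df m (t : R) : differentiable (flat m : R^o -> R^o) t.
  by apply/derivable1_diffP; exact: ex_derive.
elim: k n => [|k IH] n; first by move=> t _; exact: differentiable_continuous.
split=> // v.
apply: (@Ck_eq _ _ _ _ _ (fun t => v * (flat n.+2 t + (- n%:R) * flat n.+1 t))) => //.
- exact: openT.
- by move=> t _; rewrite diff1E //= derive1E derive_val mulNr.
- have oT := @openT R^o.
  apply: CkM => //; first exact: Ck_cst.
  by apply: CkD => //; apply: CkM => //; exact: Ck_cst.
Qed.

End FlatFunction.

Section Separation.
Variable R : realType.

(** The Euclidean distance is used because the norm of ['rV[R]_n] is the maximum norm, which is not
    smooth in general. *)
Definition sqdist n (a z : 'rV[R]_n) : R^o := \sum_i (z 0 i - a 0 i) ^+ 2.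

Lemma sqdist_gt0 n (a z : 'rV[R]_n) : z <> a -> 0 < sqdist a z.
Proof.
move=> /eqP; apply: contra_neqT; rewrite -leNgt => sq_le0; apply/rowP => i.
have sq0 : sqdist a z = 0.
  by apply/eqP; rewrite eq_le sq_le0 sumr_ge0// => j _; rewrite sqr_ge0.
have /psumr_eq0P/(_ i isT) := sq0.
by move=> /(_ (fun j _ => sqr_ge0 _))/eqP; rewrite sqrf_eq0 subr_eq0 => /eqP.
Qed.

Lemma norm_le_sqdist n (a z : 'rV[R]_n) (r : R) :
  0 < r -> sqdist a z < r ^+ 2 -> `|a - z| <= r.
Proof.
move=> r0 sq_lt; rewrite [leLHS]mx_normrE.
apply: bigmax_le; first exact: ltW.
move=> [i j] _ /=; rewrite (ord1 i) !mxE distrC -(ler_pXn2r (n := 2)) ?nnegrE ?(ltW r0)//.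
rewrite -normrX ger0_norm ?sqr_ge0//; apply: le_trans (ltW sq_lt).
by rewrite /sqdist (bigD1 j)//= lerDl sumr_ge0// => l _; rewrite sqr_ge0.
Qed.

Lemma Ck_sqdist n k (U : set 'rV[R]_n) (a : 'rV[R]_n) : open U -> Ck k U (sqdist a).
Proof.
move=> oU; apply: Ck_sum => // i.
have Ci : Ck k U (fun z : 'rV[R]_n => z 0 i - a 0 i : R^o).
  apply: CkD => //; last exact: Ck_cst.
  exact: (@Ck_linear R _ _ k U (rVcoord i) (@rVcoord_continuous R n i)).
exact: CkM.
Qed.

Lemma compact_closed_ball_rV n (a : 'rV[R]_n) (r : R) : compact (closed_ball a r).
Proof.
have [r0|r0] := leP r 0; first by rewrite closed_ball0//; exact: compact0.
apply: bounded_closed_compact; last exact: closed_ball_closed.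
rewrite closed_ballE//; exists (`|a| + r); split; first exact: num_real.
move=> b ltb z /= az; apply: le_trans (ltW ltb).
rewrite (_ : z = a - (a - z)); last by rewrite opprB addrC subrK.
by apply: le_trans (ler_normB _ _) _; rewrite lerD2l.
Qed.

(** The function is a bump around [x]: in a chart it is exp(-1/(r^2 - d^2)) at Euclidean distance d
    < r, and it vanishes elsewhere. Where positive, it decreases strictly with d. *)
Lemma smooth_fun_separates n (M : manifoldType R n) (x y : M) :
  x <> y -> exists2 f : M -> R, smooth_fun f & f x <> f y.
Proof.
move=> xy; have [c ac cx] := atlas_cover x.
have img_cx : chart_img c (chart_map c x) by exists x.
have /nbhs_closedballP[r rimg] :=
  open_nbhs_nbhs (conj (chart_img_open (c := c)) img_cx).
pose b z := flat 0 (r%:num ^+ 2 - sqdist (chart_map c x) z).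
pose f p := if `[< chart_dom c p >] then b (chart_map c p) else 0.
have fE p : chart_dom c p -> f p = b (chart_map c p).
  by move=> cp; rewrite /f asboolT.
pose K := chart_inv c @` closed_ball (chart_map c x) r%:num.
(* The Hausdorff property enters here: the compact [K] is closed, so [f] vanishes on an open set
   containing every point outside the chart domain. *)
have cK : closed K.
  apply: compact_closed; first exact: manifold_hausdorff.
  apply: continuous_compact; last exact: compact_closed_ball_rV.
  by apply: continuous_in_subspaceT => z /set_mem/rimg; exact: chart_inv_cont.
have f0 p : ~ K p -> f p = 0.
  move=> nKp; have [cp|ncp] := pselect (chart_dom c p); last by rewrite /f asboolF.
  rewrite fE// /b /flat subr_gt0 ltNge -[X in if X then _ else _]negbK.
  case: ifPn => //; rewrite negbK -ltNge => sq_lt; exfalso; apply: nKp.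
  exists (chart_map c p); last exact: chart_mapKx.
  rewrite closed_ballE//; exact: norm_le_sqdist.
have sf : smooth_fun f.
  move=> d ad k; apply: Ck_local => _ [p dp <-].
  have [cp|ncp] := pselect (chart_dom c p).
    exists (chart_map d @` (chart_dom d `&` chart_dom c)); split; first by exists p.
    have oU : open (chart_map d @` (chart_dom d `&` chart_dom c)).
      exact/open_chart_image/chart_dom_open.
    have oT : open [set: 'rV[R]_n] := openT.
    apply: (@Ck_eq _ _ _ _ _ (b \o (chart_map c \o chart_inv d))) => //.
      by move=> _ [q [dq cq] <-] /=; rewrite !chart_mapKx// fE.
    apply: (@Ck_comp_rV _ _ _ _ _ setT) => //; first exact: atlas_compat.
    apply: (@Ck_comp_scalar _ _ _ _ setT) => //; last exact: Ck_flat.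
    apply: (@Ck_eq _ _ _ _ _ (fun z => r%:num ^+ 2 + (-1) * sqdist (chart_map c x) z)) => //.
      by move=> z _; rewrite mulN1r.
    apply: CkD => //; first exact: Ck_cst.
    by apply: CkM => //; [exact: Ck_cst|exact: Ck_sqdist].
  exists (chart_map d @` (chart_dom d `&` ~` K)); split.
    exists p => //; split=> //= -[z /rimg[q cq <-]].
    by rewrite chart_mapKx// => qp; apply: ncp; rewrite -qp.
  apply: (@Ck_eq _ _ _ _ _ (cst 0)); [|move=> _ [q [dq Kq] <-]|exact: Ck_cst].
    exact/open_chart_image/closed_openC.
  by rewrite /= chart_mapKx// f0.
exists f => //; rewrite fE// /b.
have sqxx : sqdist (chart_map c x) (chart_map c x) = 0.
  by rewrite /sqdist big1// => i _; rewrite subrr expr0n.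
have r20 : 0 < r%:num ^+ 2 by rewrite exprn_gt0.
(* If [f x = f y], then [f y] is positive, so [y] lies in the chart domain and inside the ball;
   injectivity of [expR] and of inversion makes its distance to [x] zero. *)
rewrite sqxx subr0 {1}/flat r20 expr0 mul1r => fxy.
have := expR_gt0 (- (r%:num ^+ 2)^-1); rewrite fxy.
rewrite /f; case: asboolP => [cy|_]; last by rewrite ltxx.
move: fxy; rewrite fE// /b /flat; case: ifP => [s0|_]; last by rewrite ltxx.
rewrite expr0 mul1r => /expR_inj/oppr_inj/invr_inj/eqP.
rewrite eq_sym subr_eq -subr_eq0 opprD addNKr oppr_eq0 => /eqP sq0.
have : 0 < sqdist (chart_map c x) (chart_map c y).
  apply: sqdist_gt0 => cyx; apply: xy.
  by rewrite -(chart_mapKx cx) -(chart_mapKx cy) cyx.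
by rewrite sq0 ltxx.
Qed.

End Separation.

(** * Tangent vectors and the action *)

Section TangentVectors.
Variable R : realType.

Section OneManifold.
Variables (n : nat) (M : manifoldType R n).

Lemma tangent0 (x : M) : tangent x (0 : tvec R M).
Proof.
by split=> [//|a f h _ _|f h _ _]; rewrite -![(0 : tvec R M) _]/(0 : R); ring.
Qed.

Lemma tangent_lin (x : M) (a : R) (X Y : tvec R M) :
  tangent x X -> tangent x Y -> tangent x (a *: X + Y).
Proof.
move=> [X0 XD XM] [Y0 YD YM].
have E f : (a *: X + Y) f = a * X f + Y f by [].
split=> [f nsf|b f h sf sh|f h sf sh]; rewrite !E.
- by rewrite X0// Y0// mulr0 addr0.
- by rewrite XD// YD//; ring.
- by rewrite XM// YM//; ring.
Qed.

(** Let [h] separate the points. The two Leibniz rules on [h * h] give [X h = 0]; on [f * h] they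
    then give [X f = 0]. *)
Lemma tangent_disjoint (x y : M) (X : tvec R M) :
  x <> y -> tangent x X -> tangent y X -> X = 0.
Proof.
move=> xy [X0 _ XMx] [_ _ XMy]; apply/funext => f.
have [sf|/X0//] := pselect (smooth_fun f).
have [h sh /eqP hxy] := smooth_fun_separates xy.
have XE p : smooth_fun p -> X p * h x + p x * X h = X p * h y + p y * X h.
  by move=> sp; rewrite -XMx// -XMy.
have hxy0 : h x - h y != 0 by rewrite subr_eq0.
have Xh : X h = 0.
  have : 2 * (h x - h y) * X h = 0.
    rewrite (_ : _ * X h = X h * h x + h x * X h - (X h * h y + h y * X h)); last by ring.
    by rewrite XE// subrr.
  by move/eqP; rewrite !mulf_eq0 pnatr_eq0 (negPf hxy0) => /eqP.
have /eqP := XE f sf; rewrite Xh !mulr0 !addr0 -subr_eq0 -mulrBr mulf_eq0.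
by rewrite (negPf hxy0) orbF => /eqP.
Qed.

End OneManifold.

Section Tmap.
Variables (m n : nat) (M : manifoldType R m) (N : manifoldType R n).
Implicit Types (F : M -> N) (X Y : tvec R M).

Lemma tmapE F X f : smooth_fun f -> tmap F X f = X (f \o F).
Proof. by move=> sf; rewrite /tmap asboolT. Qed.

Lemma tmap_lin F (a : R) X Y : tmap F (a *: X + Y) = a *: tmap F X + tmap F Y.
Proof.
apply/funext => f; rewrite -[RHS]/(a * tmap F X f + tmap F Y f) /tmap.
by case: asboolP => // _; rewrite mulr0 addr0.
Qed.

Lemma tmap0 F : tmap F 0 = 0.
Proof. by have := tmap_lin F (-1) 0 0; rewrite !scaleN1r !oppr0 !addNr add0r => <-. Qed.

Lemma tangent_tmap F x X : smooth_map F -> tangent x X -> tangent (F x) (tmap F X).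
Proof.
move=> sF [X0 XD XM]; split=> [f nsf|a f h sf sh|f h sf sh].
- by rewrite /tmap asboolF.
- rewrite !tmapE//; last exact: smooth_fun_lin.
  by rewrite -XD//; exact: smooth_fun_comp.
- rewrite !tmapE//; last exact: smooth_funM.
  by rewrite -XM//; exact: smooth_fun_comp.
Qed.

End Tmap.

(** Both sides vanish on functions that are not smooth: [tmap F X] by definition, [X] because it is
    a tangent vector. *)
Lemma tmap_id n (M : manifoldType R n) (F : M -> M) (x : M) (X : tvec R M) :
  F =1 idfun -> tangent x X -> tmap F X = X.
Proof.
move=> /funext -> [X0 _ _]; apply/funext => f.
by rewrite /tmap; case: asboolP => // /X0.
Qed.

(** Smoothness of [F'] makes [f \o F'] smooth, so the inner [tmap] does not fall back on its default
    0. *)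
Lemma tmap_comp l m n (L : manifoldType R l) (M : manifoldType R m)
    (N : manifoldType R n) (F : L -> M) (F' : M -> N) (X : tvec R L) :
  smooth_map F' -> tmap F' (tmap F X) = tmap (F' \o F) X.
Proof.
move=> sF'; apply/funext => f; rewrite /tmap.
by case: asboolP => // sf; rewrite asboolT//; exact: smooth_fun_comp.
Qed.

End TangentVectors.

(** * Equivariance of the orbit maps under translations and the adjoint action *)

Section LieGroupAction.
Variables (R : realType) (n m : nat) (M : manifoldType R n) (G : lieGroupType R m).
Variables (act : G -> M -> M) (o : M).
Hypothesis actM : forall g h x, act (g * h)%g x = act g (act h x).
Hypothesis act_smooth : smooth_map2 act.
Hypothesis act_transitive : forall x, exists g, act g o = x.

(** Multiplicativity alone only makes [act 1] idempotent. It fixes the orbit of [o] pointwise, which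
    is everything by transitivity. *)
Lemma act1 (x : M) : act 1%g x = x.
Proof. by have [g <-] := act_transitive x; rewrite -actM mul1g. Qed.

Lemma actK (g : G) : cancel (act g) (act g^-1%g).
Proof. by move=> x; rewrite -actM mulVg act1. Qed.

Lemma smooth_act (g : G) : smooth_map (act g).
Proof. exact: smooth_map2_section_r. Qed.

Lemma smooth_orbit_proj (x : M) : smooth_map (orbit_proj act x).
Proof. exact: (smooth_map2_section_l x act_smooth). Qed.

Lemma smooth_ltrans (g : G) : smooth_map (ltrans g).
Proof. exact: (smooth_map2_section_r g lie_mul_smooth). Qed.

Lemma smooth_rtrans (g : G) : smooth_map (fun h : G => (h * g)%g).
Proof. exact: (smooth_map2_section_l g lie_mul_smooth). Qed.

Lemma tmap_actK (g : G) (x : M) (v : tvec R M) :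
  tangent x v -> tmap (act g^-1%g) (tmap (act g) v) = v.
Proof.
move=> tv; rewrite tmap_comp; last exact: smooth_act.
by apply: tmap_id tv => y; exact: actK.
Qed.

Lemma tmap_ltransK (g h : G) (X : tvec R G) :
  tangent h X -> tmap (ltrans g^-1%g) (tmap (ltrans g) X) = X.
Proof.
move=> tX; rewrite tmap_comp; last exact: smooth_ltrans.
by apply: tmap_id tX => k; rewrite /= /ltrans mulKg.
Qed.

(** Conjugation is split into two translations, each smooth as a section of the jointly smooth
    multiplication. *)
Lemma AdE (g : G) (X : tvec R G) :
  Ad g X = tmap (fun h : G => (h * g^-1)%g) (tmap (ltrans g) X).
Proof. by rewrite tmap_comp//; exact: smooth_rtrans. Qed.

Lemma lie_alg_Ad (g : G) (X : tvec R G) : lie_alg X -> lie_alg (Ad g X).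
Proof.
move=> lX; rewrite AdE /lie_alg.
have := tangent_tmap (smooth_rtrans g^-1%g) (tangent_tmap (smooth_ltrans g) lX).
by rewrite /ltrans mulg1 mulgV.
Qed.

Lemma AdKV (g : G) (X : tvec R G) : lie_alg X -> Ad g (Ad g^-1%g X) = X.
Proof.
move=> lX; rewrite AdE {1}/Ad (tmap_comp _ _ (smooth_ltrans g)).
rewrite (tmap_comp _ _ (smooth_rtrans _)).
apply: tmap_id lX => h.
by rewrite /= /ltrans invgK !mulgA mulgV mul1g mulgK.
Qed.

Lemma tmap_orbit_Ad (g : G) (x : M) (X : tvec R G) :
  tmap (orbit_proj act (act g x)) (Ad g X) = tmap (act g) (tmap (orbit_proj act x) X).
Proof.
rewrite /Ad (tmap_comp _ _ (smooth_orbit_proj _)) (tmap_comp _ _ (smooth_act g)).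
congr (tmap _ X); apply/funext => h.
by rewrite /= /orbit_proj -!actM mulgVK.
Qed.

Lemma tmap_orbit_ltrans (g : G) (x : M) (X : tvec R G) :
  tmap (orbit_proj act x) (tmap (ltrans g) X) = tmap (act g) (tmap (orbit_proj act x) X).
Proof.
rewrite tmap_comp; last exact: smooth_orbit_proj.
rewrite [RHS]tmap_comp; last exact: smooth_act.
by congr (tmap _ X); apply/funext => h; rewrite /= /orbit_proj actM.
Qed.

(** This is the derivative clause of [is_exponential] for [f \o orbit_proj act x]. It makes the
    infinitesimal action a differential, hence linear in [X]. *)
Lemma inf_actionE (e : tvec R G -> G) (X : tvec R G) (x : M) :
  is_exponential e -> lie_alg X ->
  inf_action act e X x = tmap (orbit_proj act x) X.
Proof.
move=> e_exp lX; apply/funext => f; rewrite /inf_action /velocity /tmap.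
case: asboolP => // sf; have [_ de] := e_exp X lX.
have dX := de _ (smooth_fun_comp (smooth_orbit_proj x) sf).
exact: (derive_val (is_derive := dX)).
Qed.

End LieGroupAction.

Lemma bilinear_on0r (R : realType) (V : lmodType R) (E : set V) (q : V -> V -> R) (u : V) :
  E 0 -> bilinear_on E q -> E u -> q u 0 = 0.
Proof.
move=> E0 bq Eu; have [_] := bq (-1) 0 0 u E0 E0 Eu.
by rewrite scaler0 addr0 mulN1r addNr.
Qed.

(** * Orthogonality to the kernel of d pi, and the horizontal lift *)

Section CartanDecomposition.
Variables (R : realType) (n m : nat) (M : manifoldType R n) (G : lieGroupType R m).
Variables (act : G -> M -> M) (o : M) (e : tvec R G -> G) (s : M -> M) (theta : G -> G).
Variable Q : tvec R G -> tvec R G -> R.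
Hypothesis actM : forall g h x, act (g * h)%g x = act g (act h x).
Hypothesis act_smooth : smooth_map2 act.
Hypothesis act_transitive : forall x, exists g, act g o = x.
Hypothesis e_exp : is_exponential e.
Hypothesis s_smooth : smooth_map s.
Hypothesis s_fix : s o = o.
Hypothesis theta_involution : Cartan_involution act s theta.
Hypothesis Cartan_k : lie_sub e (stabiliser act o) = dtheta_eigenspace theta 1.
Hypothesis Cartan_p : set_bij (dtheta_eigenspace theta (-1)) (tangent o)
  (fun w => inf_action act e w o).
Hypothesis Q_scalar : scalar_product_on (@lie_alg R m G) Q.
Hypothesis Q_orthogonal : forall u w, lie_sub e (stabiliser act o) u ->
  dtheta_eigenspace theta (-1) w -> Q u w = 0.

Local Notation dpi := (tmap (orbit_proj act o)).
Local Notation p := (dtheta_eigenspace theta (-1)).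

(* If [theta 1 = 1], then [theta Z - Z] lies in [p] and in the kernel of [dpi],
   hence vanishes, so that [Z] lies in the Lie algebra of the stabiliser. If
   [theta 1 <> 1], then [w] is tangent at two distinct points, so [w = 0]. *)
Lemma kernel_orthogonal (Z w : tvec R G) :
  lie_alg Z -> dpi Z = 0 -> p w -> Q Z w = 0.
Proof.
move=> lZ dZ [lw tw]; have [act_theta thetaK theta_smooth] := theta_involution.
have [bQ _ _] := Q_scalar; have [_ p_inj _] := Cartan_p.
have [theta1|theta1] := pselect (theta 1%g = 1%g); last first.
  suff -> : w = 0 by exact: bilinear_on0r (tangent0 _) bQ lZ.
  apply: (tangent_disjoint theta1 _ lw).
  have := tangent_lin (-1) (tangent_tmap theta_smooth lw) (tangent0 _).
  by rewrite tw addr0 !scaleN1r opprK.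
have ltZ : lie_alg (tmap theta Z).
  by have := tangent_tmap theta_smooth lZ; rewrite theta1.
(* As [s] fixes [o], [theta g] sends [o] to [s (act g o)]; hence d pi after d theta is ds after d
   pi, which kills [Z]. *)
have dtZ : dpi (tmap theta Z) = 0.
  rewrite tmap_comp; last exact: smooth_orbit_proj.
  rewrite (_ : _ \o _ = s \o orbit_proj act o); last first.
    by apply/funext => g; rewrite /= /orbit_proj act_theta /= s_fix.
  by rewrite -tmap_comp// dZ tmap0.
have ttZ : tmap theta (tmap theta Z) = Z.
  by rewrite tmap_comp//; exact: tmap_id lZ.
have p0 : p 0 by split; [exact: (tangent0 _)|rewrite tmap0 scaler0].
pose D := (-1) *: tmap theta Z + Z.
have pD : p D.
  split; first exact: tangent_lin.
  by rewrite tmap_lin ttZ /D scalerDr !scaleN1r opprK addrC.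
have D0 : D = 0.
  apply: p_inj; [exact: mem_set|exact: mem_set|].
  rewrite !(inf_actionE _ _ e_exp)//; [|exact: (tangent0 _)|exact: pD.1].
  by rewrite tmap_lin dtZ dZ tmap0 scaler0 addr0.
apply: Q_orthogonal => //; rewrite Cartan_k; split=> //.
by rewrite scale1r; apply/eqP; rewrite eq_sym -subr_eq0 addrC -scaleN1r -/D D0.
Qed.

(** The translate of [w] to [g] is a horizontal lift. For uniqueness, translate any lift back to
    [w']: the difference [D] from [w] lies in the kernel of d pi, so it is orthogonal to [w] by
    [kernel_orthogonal] and to [w'] by horizontality, whence [Q D D = 0]. *)
Lemma hlift_eE (g : G) (v : tvec R M) (w : tvec R G) :
  tangent (act g o) v -> p w -> dpi w = tmap (act g^-1%g) v ->
  hlift_e act Q o g v = w.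
Proof.
move=> tv pw dw; have lw := pw.1; have [bQ sQ posQ] := Q_scalar.
have ltransV h X : tangent h X -> tmap (ltrans g) (tmap (ltrans g^-1%g) X) = X.
  by move=> tX; have := tmap_ltransK g^-1%g tX; rewrite invgK.
have actV h X : tangent h X -> tmap (act g) (tmap (act g^-1%g) X) = X.
  by move=> tX; have := tmap_actK actM act_smooth act_transitive g^-1%g tX; rewrite invgK.
have lie_ltransV X : tangent g X -> lie_alg (tmap (ltrans g^-1%g) X).
  by move=> tX; have := tangent_tmap (smooth_ltrans g^-1%g) tX; rewrite /ltrans mulVg.
have tangent_ltrans X : lie_alg X -> tangent g (tmap (ltrans g) X).
  by move=> lX; have := tangent_tmap (smooth_ltrans g) lX; rewrite /ltrans mulg1.
have dL h X : dpi (tmap (ltrans h) X) = tmap (act h) (dpi X).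
  exact: tmap_orbit_ltrans.
(* A lift is exhibited first, since [xget] returns the default 0 on an empty set. *)
have [] : [set X | horizontal act Q o g X /\ dpi X = v] (hlift act Q o g v).
  apply: xgetPex; exists (tmap (ltrans g) w); split; last by rewrite dL dw (actV _ _ tv).
  split=> [|Y [tY dY]]; first exact: tangent_ltrans.
  rewrite /left_invariant_metric (tmap_ltransK _ lw) sQ//; last exact: lie_ltransV.
  by apply: kernel_orthogonal => //; [exact: lie_ltransV|rewrite dL dY tmap0].
rewrite /hlift_e; move: (hlift _ _ _ _ _) => X [tX hX] dX.
set w' := tmap _ X; have lw' : lie_alg w' by exact: lie_ltransV.
pose D := (-1) *: w + w'.
have lD : lie_alg D by exact: tangent_lin.
have dD : dpi D = 0 by rewrite tmap_lin dL dX dw scaleN1r addNr.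
have Dw : Q D w = 0 by exact: kernel_orthogonal.
(* Horizontality of [X] is tested on the vertical vector that translates [D] to [g]. *)
have Dw' : Q D w' = 0.
  rewrite sQ// -(hX (tmap (ltrans g) D)).
    by rewrite /left_invariant_metric (tmap_ltransK _ lD).
  by split; [exact: tangent_ltrans|rewrite dL dD tmap0].
have QDD : Q D D = 0.
  by have [_ ->] := bQ (-1) w w' D lw lw' lD; rewrite Dw Dw' mulr0 addr0.
have D0 : D = 0.
  apply: contrapT => /eqP/(posQ D lD); by rewrite QDD ltxx.
by apply/eqP; rewrite -subr_eq0 addrC -scaleN1r -/D D0.
Qed.

End CartanDecomposition.

Theorem proposition1p9 (R : realType) (n m : nat)
  (M : manifoldType R n) (ip : riemannian M) (o : M)
  (G : lieGroupType R m) (act : G -> M -> M)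
  (e : tvec R G -> G) (s : M -> M) (theta : G -> G)
  (Q B : tvec R G -> tvec R G -> R)
  (M_symmetric : symmetric_space ip)
  (G_isometry : isometry_identity_component ip act)
  (M_homogeneous : forall x : M, exists g : G, act g o = x)
  (G_reductive : reductive G)
  (e_exp : is_exponential e)
  (s_symmetry : geodesic_symmetry ip o s)
  (theta_involution : Cartan_involution act s theta)
  (Cartan_k : lie_sub e (stabiliser act o) = dtheta_eigenspace theta 1)
  (Cartan_p : set_bij (dtheta_eigenspace theta (-1)) (tangent o)
                (fun w => inf_action act e w o))
  (Q_scalar : scalar_product_on (@lie_alg R m G) Q)
  (Q_AdK : Ad_invariant (stabiliser act o) Q)
  (Q_orthogonal : forall u w, lie_sub e (stabiliser act o) u ->
     dtheta_eigenspace theta (-1) w -> Q u w = 0)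
  (Q_metric : forall (g : G) (u v : tvec R M) (w1 w2 : tvec R G),
     tangent (act g o) u -> tangent (act g o) v ->
     dtheta_eigenspace theta (-1) w1 -> dtheta_eigenspace theta (-1) w2 ->
     tmap (act g^-1%g) u = inf_action act e w1 o ->
     tmap (act g^-1%g) v = inf_action act e w2 o ->
     ip (act g o) u v = Q w1 w2)
  (B_case : noncompact_case theta Q B \/ compact_case Q B) :
  forall (g : G) (x : M) (v : tvec R M),
    x = orbit_proj act o g -> tangent x v ->
    let omega_v := Ad g (hlift_e act Q o g v) in
    inf_action act e omega_v x = v /\
    forall (xi : tvec R G) (u : tvec R M),
      lie_alg xi -> u = inf_action act e xi x -> ip x u v = B xi omega_v.
Proof.
move=> g x v xE tv omega_v; rewrite {}xE in tv *.
have [[actM _] _ _ act_smooth] := G_isometry.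
have [[[_ [s_smooth _ _ _]] _] s_fix _] := s_symmetry.
have [_ _ p_surj] := Cartan_p.
have infE := inf_actionE act_smooth _ e_exp.
have act1 := act1 actM M_homogeneous.
have dact_o (u : tvec R M) : tangent (act g o) u -> tangent o (tmap (act g^-1%g) u).
  move=> /(tangent_tmap (smooth_act act_smooth g^-1%g)).
  by rewrite -actM mulVg act1.
have dactK (y : M) (u : tvec R M) :
    tangent y u -> tmap (act g) (tmap (act g^-1%g) u) = u.
  by have := @tmap_actK _ _ _ _ _ _ _ actM act_smooth M_homogeneous g^-1%g y u; rewrite invgK.
have [w pw wv] := p_surj _ (dact_o _ tv).
have lw : lie_alg w := pw.1.
have dw : tmap (orbit_proj act o) w = tmap (act g^-1%g) v by rewrite -infE.
have ker_orth := kernel_orthogonal act_smooth e_exp s_smooth s_fix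
  theta_involution Cartan_k Cartan_p Q_scalar Q_orthogonal.
have omegaE : omega_v = Ad g w.
  congr (Ad g _).
  exact: (hlift_eE actM act_smooth M_homogeneous e_exp s_smooth s_fix
    theta_involution Cartan_k Cartan_p Q_scalar Q_orthogonal tv pw dw).
split.
  rewrite omegaE infE; last exact: lie_alg_Ad.
  by rewrite tmap_orbit_Ad// dw (dactK _ _ tv).
move=> xi u lxi uE; pose eta := Ad g^-1%g xi.
have leta : lie_alg eta by exact: lie_alg_Ad.
have xiE : xi = Ad g eta by rewrite /eta (AdKV g lxi).
have deta : tangent o (tmap (orbit_proj act o) eta).
  have := tangent_tmap (smooth_orbit_proj act_smooth o) leta.
  by rewrite /orbit_proj act1.
have uE' : u = tmap (act g) (tmap (orbit_proj act o) eta).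
  by rewrite uE infE// xiE -tmap_orbit_Ad.
(* The p-component [z] of [eta] is obtained as the vector of p with the same image under d pi. *)
have [z pz zE] := p_surj _ deta; rewrite infE in zE; last exact: pz.1.
have lz : lie_alg z := pz.1; have [bQ _ _] := Q_scalar.
have -> : ip (act g o) u v = Q z w.
  apply: Q_metric => //.
    rewrite uE'; exact: tangent_tmap (smooth_act act_smooth g) deta.
  by rewrite uE' (tmap_actK actM act_smooth M_homogeneous g deta) infE.
have -> : Q z w = Q eta w.
  have lD : lie_alg ((-1) *: z + eta) by exact: tangent_lin.
  have : Q ((-1) *: z + eta) w = 0.
    by apply: ker_orth => //; rewrite tmap_lin zE scaleN1r addNr.
  by have [-> _] := bQ (-1) z eta w lz leta lw; rewrite mulN1r addrC => /subr0_eq.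
rewrite omegaE xiE.
(* The compact case is Ad-invariance of [Q]. In the non-compact case, d theta w = -w turns Q(eta, w)
   = -B(eta, d theta w) into B(eta, w). *)
have [[bB _ _ AdB QB]|[AdQ QB]] := B_case; last by rewrite QB ?AdQ//; exact: lie_alg_Ad.
rewrite AdB// QB// pw.2.
have [_] := bB (-1) w 0 eta lw (tangent0 _) leta.
by rewrite addr0 (bilinear_on0r (tangent0 _) bB leta) addr0 mulN1r => ->; rewrite opprK.
Qed.
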